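(* Let $n$ and $k$ be integers with $2\le k\le n-2$. There is no $(n-1)$-resilient algorithm that solves $k$-set agreement in an asynchronous system of $n$ processes with failure detector $(\Sigma_k,\Omega_k)$.
   Context: Processes and runs. $\Pi=\{p_1,\dots,p_n\}$ is a set of $n$ processes with unique ids $1,\dots,n$ communicating by message passing, with messages from a (possibly infinite) universe $M$. Each process has a message buffer containing the messages sent to it but not yet received. Each process $p$ is a deterministic state machine whose local state contains an input (proposal) value $x_p$ from a finite set $V$ with $|V|\ge n$, and a write-once output (decision) value $y_p\in V\cup\{\bot\}$, initially $\bot\notin V$; all other components are initialized to fixed values. In a step, a process atomically takes its current local state, a (possibly empty) subset $L$ of the messages in its buffer, and the value obtained by querying the failure detector, and moves to a new local state according to the transition relation; a deterministic message sending function maps the current state and $L$ to a subset of $\Pi\times M$, and each $(q,m)$ in it is sent by placing $m$ in $q$'s buffer. A configuration is the vector of local states together with all message buffers; initially all processes are in initial states and all buffers are empty. A run is an infinite sequence of configurations $(C_0,C_1,\dots)$ starting from an initial configuration, where $C_i$ results from $C_{i-1}$ by a legitimate step of a single process (the $i$th step, occurring at time $i$). Processes have no access to time. Asynchronous system. Every correct process takes infinitely many steps; faulty (crashing) processes take only finitely many steps and may omit sending messages to a subset of the receivers in their very last step; every message sent to a correct process is eventually received. There are no bounds on process speeds or message delays. An $(n-1)$-resilient algorithm must work in all admissible runs with at most $n-1$ faulty processes. Failure detectors. The failure pattern $F(\cdot)$ of a run gives the set $F(t)$ of processes crashed at time $t$: $p\in F(t)$ iff there is no $i\ge t$ such that the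 $i$th step is a step of $p$. The set of faulty processes is $F=\bigcup_{t\ge 0}F(t)$. A failure detector assigns to each failure pattern a set of admissible histories; a history $H(p,t)$ is the value returned to a query by $p$ at time $t$. A run is admissible if all steps use the values of some history admissible for its failure pattern. $\Sigma_k$: $H(p,t)$ is a set of process ids such that (Intersection) for every set of $k+1$ processes $\{p_1,\dots,p_{k+1}\}$ and all times $t_1,\dots,t_{k+1}$ there are indices $1\le i\ne j\le k+1$ with $H(p_i,t_i)\cap H(p_j,t_j)\ne\emptyset$; (Liveness) $\exists t\,\forall t'\ge t\,\forall p_i\notin F:\ H(p_i,t')\cap F=\emptyset$. By convention, if $p\in F(t)$ then $H(p,t')=\Pi$ for all $t'\ge t$. $\Omega_k$ ($1\le k\le n-1$): (Validity) for all $p,t$, $H(p,t)$ is a set of $k$ process ids; (Eventual Leadership) there exist a time $t_{\mathrm{GST}}$ and a set $LD$ with $LD\cap(\Pi\setminus F)\ne\emptyset$ and $H(p,t)=LD$ for all $t\ge t_{\mathrm{GST}}$ and all $p$. The failure detector $(\Sigma_k,\Omega_k)$ outputs pairs, the first component satisfying $\Sigma_k$ and the second $\Omega_k$. $k$-set agreement. An algorithm solves $k$-set agreement if in all its admissible runs: ($k$-Agreement) processes (correct or faulty) decide on at most $k$ different values; (Validity) if a process decides on $v$, then $v$ was proposed by some process; (Termination) every correct process eventually decides, i.e. irrevocably sets its output. *)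

(* Defs.v *)
From mathcomp Require Import boolp classical_sets.
(* Loaded last so that [set0], [setT], ... are those of [finset]. *)
From mathcomp Require Import all_boot.

Set Implicit Arguments.
Unset Strict Implicit.
Unset Printing Implicit Defensive.

(* Processes are the elements of ['I_n].  Finite sets of processes are
   [{set 'I_n}]; sets of messages, which may be infinite, are classical sets
   [set M].  Times are natural numbers. *)

(** * Algorithms *)

(* [decision s = None] encodes the undecided output value. *)
Record lstate (V S : Type) := LState {
  proposal : V;
  decision : option V;
  internal : S
}.

(* [M] is the universe of messages and [D] the range of the failure detector.
   The process id is an argument of each component, so different processes may
   run different code.  Using one type of internal states for all processes is
   no restriction (take a disjoint union). *)
Record algorithm (n : nat) (V M D : Type) := Algorithm {
  internal_type : Type;
  init : 'I_n -> internal_type;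
  trans : 'I_n -> lstate V internal_type -> set M -> D -> lstate V internal_type;
  send : 'I_n -> lstate V internal_type -> set M -> set ('I_n * M);
  trans_write_once : forall p s L d v,
    decision s = Some v -> decision (trans p s L d) = Some v
}.
Arguments init {n V M D} A p : rename.
Arguments trans {n V M D} A p s L d : rename.
Arguments send {n V M D} A p s L : rename.
Arguments trans_write_once {n V M D} A p s L d v : rename.

Section Model.
Variables (n : nat) (V M D : Type) (A : algorithm n V M D).

(* Buffers are sets: a message sent again while still in the buffer is not
   duplicated.  Algorithms that need to tell copies apart can tag messages with
   the sender and a sequence number, [M] being arbitrary. *)
Record config := Config {
  state : 'I_n -> lstate V (internal_type A);
  buffer : 'I_n -> set M
}.

(* [omitted] is the set of receivers to which the messages of this step are not
   sent; see [omission_ok] for when it may be nonempty. *)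
Record step := Step {
  actor : 'I_n;
  received : set M;
  fdval : D;
  omitted : {set 'I_n}
}.

Definition initial (C : config) : Prop :=
  forall p, [/\ decision (state C p) = None,
                internal (state C p) = init A p
              & forall m, ~ buffer C p m].

Definition legitimate (C : config) (e : step) : Prop :=
  forall m, received e m -> buffer C (actor e) m.

Definition sent (C : config) (e : step) (q : 'I_n) (m : M) : Prop :=
  send A (actor e) (state C (actor e)) (received e) (q, m) /\ q \notin omitted e.

(* Messages received in a step leave the buffer before those sent in the same
   step enter it. *)
Definition next_config (C : config) (e : step) : config := {|
  state := fun q =>
    if q == actor e then trans A q (state C q) (received e) (fdval e)
    else state C q;
  buffer := fun q m =>
    (buffer C q m /\ ~ (q = actor e /\ received e m)) \/ sent C e q m
|}.

(* [ev i] leads from [conf i] to [conf i.+1]: it is the [i.+1]-st step, which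
   occurs at time [i.+1]. *)
Record run := Run {
  conf : nat -> config;
  ev : nat -> step;
  run_initial : initial (conf 0);
  run_legitimate : forall i, legitimate (conf i) (ev i);
  run_next : forall i, conf i.+1 = next_config (conf i) (ev i)
}.

End Model.

(** * Failure patterns and failure detectors *)

Definition failure_pattern (n : nat) := nat -> {set 'I_n}.

Definition faulty n (F : failure_pattern n) : {set 'I_n} :=
  [set p | `[< exists t, p \in F t >]].

Definition history (n : nat) (D : Type) := 'I_n -> nat -> D.

(* The set of admissible histories of each failure pattern. *)
Definition failure_detector (n : nat) (D : Type) :=
  failure_pattern n -> set (history n D).

(* Injectivity of [p]: intersection is required of [k.+1] distinct processes.
   The last clause is the convention on the output at crashed processes. *)
Definition Sigma n (k : nat) : failure_detector n {set 'I_n} := fun F H =>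
  [/\ forall (p : 'I_k.+1 -> 'I_n) (t : 'I_k.+1 -> nat), injective p ->
        exists i j, i != j /\ H (p i) (t i) :&: H (p j) (t j) != set0,
      exists t, forall t', t <= t' -> forall p, p \notin faulty F ->
        H p t' :&: faulty F = set0
    & forall p t, p \in F t -> forall t', t <= t' -> H p t' = [set: 'I_n]].

Definition Omega n (k : nat) : failure_detector n {set 'I_n} := fun F H =>
  (forall p t, #|H p t| = k) /\
  (exists (tGST : nat) (LD : {set 'I_n}),
      LD :&: ~: faulty F != set0 /\
      forall t, tGST <= t -> forall p, H p t = LD).

Definition pair_detector n (D1 D2 : Type) (X1 : failure_detector n D1)
    (X2 : failure_detector n D2) : failure_detector n (D1 * D2) := fun F H =>
  X1 F (fun p t => (H p t).1) /\ X2 F (fun p t => (H p t).2).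

(** * Admissible runs and k-set agreement *)

Section Admissible.
Variables (n : nat) (V : finType) (M D : Type) (A : algorithm n V M D).

Definition pattern_of (r : run A) : failure_pattern n := fun t =>
  [set p | `[< ~ exists i, t <= i.+1 /\ actor (ev r i) = p >]].

Definition omission_ok (r : run A) : Prop :=
  forall i, omitted (ev r i) != set0 ->
    forall j, i < j -> actor (ev r j) != actor (ev r i).

Definition delivery_ok (r : run A) : Prop :=
  forall i q m, sent (conf r i) (ev r i) q m -> q \notin faulty (pattern_of r) ->
    exists j, [/\ i < j, actor (ev r j) = q & received (ev r j) m].

(* That the faulty processes are exactly those taking finitely many steps holds
   by the definition of [pattern_of]. *)
Definition admissible (f : nat) (X : failure_detector n D) (r : run A) : Prop :=
  [/\ #|faulty (pattern_of r)| <= f,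
      omission_ok r,
      delivery_ok r
    & exists H, X (pattern_of r) H /\
        forall i, fdval (ev r i) = H (actor (ev r i)) i.+1].

Definition decides (r : run A) (p : 'I_n) (v : V) : Prop :=
  exists t, decision (state (conf r t) p) = Some v.

Definition agreement (k : nat) (r : run A) : Prop :=
  #|[set v : V | `[< exists p, decides r p v >]]| <= k.

Definition validity (r : run A) : Prop :=
  forall p v, decides r p v -> exists q, proposal (state (conf r 0) q) = v.

(* Irrevocability of decisions is [trans_write_once]. *)
Definition termination (r : run A) : Prop :=
  forall p, p \notin faulty (pattern_of r) -> exists v, decides r p v.

Definition solves_set_agreement (f k : nat) (X : failure_detector n D) : Prop :=
  forall r : run A, admissible f X r ->
    [/\ agreement k r, validity r & termination r].

End Admissible.

(* Main.v *)
Require Import Defs.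
From mathcomp Require Import boolp classical_sets.
From mathcomp Require Import all_boot.

(* Split off a set [B] of three processes and a set [Q] of [k.-1] further ones.
   [Sigma] may output [{q}] at each [q] in [Q] and sets of two or three
   processes of [B] at the processes of [B].  Each [q] in [Q] can be run alone
   until it decides its own proposal, unnoticed by [B]; hence the processes of
   [B] must reach consensus among themselves.  Meanwhile [Omega] may output
   constantly a set containing two processes of [B], which gives no information
   as long as at most one process of [B] crashes, so an argument of the kind of
   Fischer, Lynch and Paterson applies.

   The version used here is due to Voelzer.  For [p] in [B], consider the set of
   values that can still be decided in [B] without any step of [p].  It is never
   empty, it can only grow when [p] takes a step and only shrink when another
   process does.  From a configuration where two decisions are possible in [B],
   follow a schedule that decides a value other than one reachable without [p]:
   on the way there is a configuration where two values are reachable without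
   [p], and they remain so after [p] has received its whole buffer.  Serving the
   processes of [B] in turn gives a fair run in which none of them decides. *)

Set Implicit Arguments.
Unset Strict Implicit.
Unset Printing Implicit Defensive.

Lemma card_ord_interval n a b :
  b <= n -> #|[set i : 'I_n | a <= i < b]| = b - a.
Proof.
move=> bn; rewrite -sum1dep_card -[RHS]muln1 -sum_nat_const_nat.
rewrite (big_nat_widen _ _ _ _ _ bn) big_geq_mkord.
by apply: eq_bigl => i; rewrite andbC.
Qed.

(** * Schedules *)

Section Schedules.
Variables (n : nat) (V M D : Type) (A : algorithm n V M D).
Implicit Types (C : config A) (e : step n M D) (s : seq (step n M D)).
Implicit Types (P : {set 'I_n}) (p q : 'I_n).

Definition exec C s : config A := foldl (@next_config n V M D A) C s.

Fixpoint legal C s : Prop :=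
  if s is e :: s' then legitimate C e /\ legal (next_config C e) s' else True.

Lemma exec_cat C s1 s2 : exec C (s1 ++ s2) = exec (exec C s1) s2.
Proof. exact: foldl_cat. Qed.

Lemma legal_cat C s1 s2 :
  legal C (s1 ++ s2) <-> legal C s1 /\ legal (exec C s1) s2.
Proof. by elim: s1 C => [|e s1 IH] C //=; [tauto | rewrite IH; tauto]. Qed.

Lemma decision_next C e p v :
  decision (state C p) = Some v ->
  decision (state (next_config C e) p) = Some v.
Proof. by move=> H /=; case: ifP => // _; apply: trans_write_once. Qed.

Lemma decision_exec C s p v :
  decision (state C p) = Some v -> decision (state (exec C s) p) = Some v.
Proof. by elim: s C => [|e s IH] C //= H; apply/IH/decision_next. Qed.

Definition acts_in P e := actor e \in P.

(* Buffers merge duplicates, so steps of different processes do not commute in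
   general: a message resent before being received is lost, one resent
   afterwards is not.  Hence inclusion of buffers rather than equality. *)
Definition embeds P C C' : Prop := forall p, p \in P ->
  state C p = state C' p /\ (forall m, buffer C p m -> buffer C' p m).

Lemma embeds_trans P C1 C2 C3 :
  embeds P C1 C2 -> embeds P C2 C3 -> embeds P C1 C3.
Proof.
move=> H12 H23 p pP; have [-> b12] := H12 p pP; have [-> b23] := H23 p pP.
by split=> // m /b12 /b23.
Qed.

Lemma embeds_legitimate P C C' e :
  embeds P C C' -> acts_in P e -> legitimate C e -> legitimate C' e.
Proof. by move=> H /H[_ sub] leg m /leg /sub. Qed.

Lemma embeds_next P C C' e :
  embeds P C C' -> acts_in P e ->
  embeds P (next_config C e) (next_config C' e).
Proof.
move=> H eP p pP; have [eqS sub] := H p pP; have [eqA _] := H _ eP.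
split=> [|m] /=; first by rewrite eqS.
by rewrite /sent eqA => -[[/sub bm nr]|sm]; [left | right].
Qed.

Lemma embeds_legal P C C' s :
  embeds P C C' -> all (acts_in P) s -> legal C s -> legal C' s.
Proof.
elim: s C C' => [|e s IH] C C' //= H /andP[eP sP] [leg legs].
split; first exact: (embeds_legitimate H eP leg).
exact: IH (embeds_next H eP) sP legs.
Qed.

Lemma embeds_exec P C C' s :
  embeds P C C' -> all (acts_in P) s -> embeds P (exec C s) (exec C' s).
Proof.
elim: s C C' => [|e s IH] C C' //= H /andP[eP sP].
exact: IH (embeds_next H eP) sP.
Qed.

Lemma embeds_other_step P C e : ~~ acts_in P e -> embeds P C (next_config C e).
Proof.
move=> eP p pP; have pe : p != actor e.
  by apply: contraNneq eP => E; rewrite /acts_in -E.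
split=> [|m mb] /=; first by rewrite (negPf pe).
by left; split=> // -[E _]; rewrite E eqxx in pe.
Qed.

Lemma embeds_other P C s :
  all (predC (acts_in P)) s -> embeds P C (exec C s).
Proof.
elim: s C => [|e s IH] C //= /andP[eP sP].
exact: embeds_trans (embeds_other_step C eP) (IH _ sP).
Qed.

(** Emptying the buffer at every service reduces delivery to serving each correct process infinitely
    often. *)
Definition full_receive C p (d : D) : step n M D :=
  Step p (buffer C p) d set0.

Lemma legitimate_full C p d : legitimate C (full_receive C p d).
Proof. by []. Qed.

(** The prefixes form a chain with [j <= size (S j)], so the event [i] can be read off [S i.+1]. *)
Lemma run_of_prefixes (e0 : step n M D) C0 (S : nat -> seq (step n M D)) :
  initial C0 -> (forall j, legal C0 (S j)) ->
  (forall j, exists2 t, 0 < size t & S j.+1 = S j ++ t) ->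
  exists r : run A,
    (forall j i, i <= size (S j) -> conf r i = exec C0 (take i (S j))) /\
    (forall j i, i < size (S j) -> ev r i = nth e0 (S j) i).
Proof.
move=> ini leg ext.
have pre i j : i <= j -> exists t, S j = S i ++ t.
  elim: j => [|j IH]; first by rewrite leqn0 => /eqP->; exists [::]; rewrite cats0.
  rewrite leq_eqVlt => /predU1P[->|]; first by exists [::]; rewrite cats0.
  rewrite ltnS => /IH[t Et]; have [t' _ ->] := ext j.
  by exists (t ++ t'); rewrite Et catA.
have szS j : j <= size (S j).
  elim: j => // j IH; have [[//|x t] _ ->] := ext j.
  by rewrite size_cat addnS ltnS (leq_trans IH) ?leq_addr.
have coh_take i j j' : i <= size (S j) -> i <= size (S j') ->
    take i (S j) = take i (S j').
  wlog le : j j' / j <= j'.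
    by move=> W; case: (leqP j j') => [|/ltnW] le h h'; [|symmetry]; apply: W.
  by move=> h _; have [t ->] := pre _ _ le; rewrite takel_cat.
have coh_nth i j j' : i < size (S j) -> i < size (S j') ->
    nth e0 (S j) i = nth e0 (S j') i.
  move=> h h'; rewrite -(nth_take _ (ltnSn i)) (coh_take _ _ j') //.
  by rewrite nth_take.
pose cf i := exec C0 (take i (S i)); pose ef i := nth e0 (S i.+1) i.
have nxt i : cf i.+1 = next_config (cf i) (ef i).
  have h : i < size (S i.+1) by exact: szS.
  rewrite /cf (coh_take i i i.+1) ?(ltnW h) // (take_nth e0 h) -cats1.
  by rewrite exec_cat.
have legi i : legitimate (cf i) (ef i).
  have h : i < size (S i.+1) by exact: szS.
  have := leg i.+1; rewrite -(cat_take_drop i (S i.+1)) legal_cat => -[_].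
  rewrite (drop_nth e0 h) /= => -[+ _].
  by rewrite /cf (coh_take i i i.+1) // ltnW.
have ini0 : initial (cf 0) by rewrite /cf take0.
exists (Run ini0 legi nxt); split=> j i h /=.
  by rewrite /cf (coh_take i i j).
exact: coh_nth.
Qed.

End Schedules.

(** * Admissible runs *)

Section FairRuns.
Variables (n k : nat) (V : finType) (M : Type).
Notation fdval_type := ({set 'I_n} * {set 'I_n})%type.
Variable A : algorithm n V M fdval_type.
(* [safe p X]: the value [X] may be output by [Sigma] at [p] at any time. *)
Variable safe : 'I_n -> {set 'I_n} -> bool.
Hypothesis safeT : forall p, safe p [set: 'I_n].
Hypothesis safe_inter : forall (p : 'I_k.+1 -> 'I_n) (X : 'I_k.+1 -> {set 'I_n}),
  injective p -> (forall i, safe (p i) (X i)) ->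
  exists i j, i != j /\ X i :&: X j != set0.
Implicit Types (C : config A) (e : step n M fdval_type).
Implicit Types (s : seq (step n M fdval_type)).
Implicit Types (P L : {set 'I_n}) (p q : 'I_n).

Notation detector := (pair_detector (@Sigma n k) (@Omega n k)).

(** Imposed on every step, whereas [stable_step] is imposed only from some time on, with [P] the set
    of correct processes and [L] the final leader set. *)
Definition safe_step e :=
  [&& omitted e == set0, safe (actor e) (fdval e).1 & #|(fdval e).2| == k].

Definition stable_step P L e :=
  [&& actor e \in P, (fdval e).1 \subset P & (fdval e).2 == L].

Record stable P L : Prop := Stable {
  stable_safe : forall p, p \in P -> safe p P;
  stable_card : #|L| = k;
  stable_meet : L :&: P != set0
}.

Lemma fair_admissible (r : run A) P L T : stable P L ->
  (forall i, safe_step (ev r i)) ->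
  (forall i, T <= i -> stable_step P L (ev r i)) ->
  (forall p i, p \in P -> exists j, [/\ i <= j, actor (ev r j) = p
     & received (ev r j) = buffer (conf r j) p]) ->
  faulty (pattern_of r) = ~: P /\ admissible n.-1 detector r.
Proof.
move=> [sP cL mL] safes stabs fair.
have crashed p t : p \in pattern_of r t ->
    forall i, t <= i.+1 -> actor (ev r i) <> p.
  by rewrite inE => /asboolP H i ti ai; apply: H; exists i.
have live p t : p \in P -> p \notin pattern_of r t.
  move=> pP; have [j [tj aj _]] := fair p t pP; apply/negP => /crashed.
  by move=> /(_ j (leqW tj)).
have faultyE : faulty (pattern_of r) = ~: P.
  apply/setP=> p; rewrite in_setC [in LHS]inE; apply/asboolP/idP => [[t]|pP].
    by apply: contraL => /live.
  exists T.+1; rewrite inE; apply/asboolP => -[i [Ti ai]].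
  by have /and3P[] := stabs i Ti; rewrite ai (negPf pP).
split=> //; split.
- have [x /setIP[_ xP]] := set0Pn _ mL.
  rewrite faultyE cardsCs setCK card_ord.
  by rewrite -subn1 leq_sub2l // card_gt0; apply/set0Pn; exists x.
- by move=> i; have /and3P[/eqP-> _ _] := safes i; rewrite eqxx.
- move=> i q m sm; rewrite faultyE inE negbK => qP.
  have [j [ij aj recv]] := fair q i.+1 qP.
  have : buffer (conf r i.+1) q m by rewrite run_next; right.
  (* Induction on the distance to step [j], at which [q] receives its whole buffer: the message
     stays in the buffer unless received on the way. *)
  have : forall d l, j - l = d -> i < l -> l <= j -> buffer (conf r l) q m ->
      exists j0, [/\ i < j0, actor (ev r j0) = q & received (ev r j0) m].
    elim=> [|d IH] l dl il lj bm.
      have E : l = j by apply/anti_leq; rewrite lj -subn_eq0 dl.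
      by rewrite E in il bm; exists j; rewrite recv.
    have [[al rl]|no] := pselect (q = actor (ev r l) /\ received (ev r l) m).
      by exists l.
    have ltlj : l < j by rewrite -subn_gt0 dl.
    apply: (IH l.+1) => //; [by rewrite subnS dl | exact: leqW |].
    by rewrite run_next; left.
  by apply; first reflexivity.
(* The history records what each step saw, [ev r i] occurring at time [i.+1]. Elsewhere processes
   outside [P] get the full set, as the convention on crashed processes demands. *)
pose H p t : fdval_type :=
  if t is i.+1 then
    if actor (ev r i) == p then fdval (ev r i)
    else (if p \in P then P else setT, L)
  else (if p \in P then P else setT, L).
exists H; split; last by move=> i; rewrite /H eqxx.
have safeH p t : safe p (H p t).1.
  have dflt : safe p (if p \in P then P else setT) by case: ifP => // /sP.
  case: t => [|i] //=; case: eqP => [<-|//].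
  by have /and3P[] := safes i.
split; split.
- by move=> p t injp; apply: safe_inter injp _ => i; apply: safeH.
- exists T.+1 => -[//|i] Ti p; rewrite faultyE inE negbK => pP.
  apply/eqP; rewrite -subset0 -(setICr P) setSI //= pP; case: eqP => // _.
  by have /and3P[] := stabs i Ti.
- move=> p t pt [|i] ti; have pP : p \notin P by apply: contraL pt => /live.
    by rewrite /= (negPf pP).
  by rewrite /= (negPf pP); case: eqP => // /(crashed _ _ pt).
- move=> p [|i] //=; case: eqP => // _.
  by have /and3P[_ _ /eqP] := safes i.
exists T.+1, L; split; first by rewrite faultyE setCK.
move=> [//|i] Ti p /=; case: eqP => // _.
by have /and3P[_ _ /eqP] := stabs i Ti.
Qed.

(* [Inv] is an invariant of the finite prefixes; keeping it while serving each
   process of [P] once more can be iterated to an admissible run. *)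
Lemma admissible_extension P L C0 s0 (Inv : seq (step n M fdval_type) -> Prop) :
  stable P L -> initial C0 -> legal C0 s0 -> all safe_step s0 -> Inv s0 ->
  (forall s p, Inv s -> legal C0 s -> p \in P -> exists t d,
    let e := full_receive (exec C0 (s ++ t)) p d in
    [/\ legal C0 (s ++ t), all safe_step (rcons t e),
        all (stable_step P L) (rcons t e) & Inv (s ++ rcons t e)]) ->
  exists r : run A, [/\ admissible n.-1 detector r,
    faulty (pattern_of r) = ~: P, conf r 0 = C0 &
    forall m, exists s, [/\ m <= size s, Inv s &
      forall i, i <= size s -> conf r i = exec C0 (take i s)]].
Proof.
move=> stab ini leg0 safe0 inv0 grow.
have [x /setIP[_ xP]] := set0Pn _ (stable_meet stab).
pose good s := Inv s /\ legal C0 s.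
have /choice[f fP] : forall sp : seq (step n M fdval_type) * 'I_n, exists t,
    good sp.1 -> sp.2 \in P ->
    [/\ good (sp.1 ++ t), all safe_step t, all (stable_step P L) t &
     exists t' d, t = rcons t' (full_receive (exec C0 (sp.1 ++ t')) sp.2 d)].
  move=> [s p] /=; have [[g pP]|no] := pselect (good s /\ p \in P); last first.
    by exists [::] => g pP; case: no.
  have [t [d [leg saf sta inv]]] := grow s p g.1 g.2 pP.
  exists (rcons t (full_receive (exec C0 (s ++ t)) p d)) => _ _.
  split=> //; last by exists t, d.
  split=> //; rewrite -rcons_cat -cats1 legal_cat; split=> //.
  by split=> //; apply: legitimate_full.
(* Round robin: the extension number [j] ends with a full receive by [pr j]. *)
pose pr j := nth x (enum P) (j %% #|P|).
have cP : 0 < #|P| by rewrite card_gt0; apply/set0Pn; exists x.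
have prP j : pr j \in P by rewrite -mem_enum mem_nth // -cardE ltn_mod.
pose S := fix S j := if j is j'.+1 then S j' ++ f (S j', pr j') else s0.
have gS j : good (S j) /\ all safe_step (S j).
  elim: j => [|j [gj sj]] //=; have [] := fP (S j, pr j) gj (prP j).
  by rewrite all_cat sj => ? -> _ _.
have fS j := fP (S j, pr j) (gS j).1 (prP j).
pose e0 := full_receive C0 x (P, L).
have [||r [rc re]] := run_of_prefixes e0 (S := S) ini.
- by move=> j; case: (gS j) => -[].
- move=> j; exists (f (S j, pr j)) => //.
  by have [_ _ _ [t' [d ->]]] := fS j; case: t'.
have szS i : i <= size (S i).
  elim: i => // i IH; have [_ _ _ [t' [d /= ->]]] := fS i.
  by rewrite size_cat size_rcons addnS ltnS (leq_trans IH) ?leq_addr.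
have stS j : all (stable_step P L) (drop (size s0) (S j)).
  elim: j => [|j IH] /=; first by rewrite drop_size.
  have le : size s0 <= size (S j).
    elim: j {IH} => //= j IH; rewrite size_cat (leq_trans IH) ?leq_addr //.
  rewrite drop_cat; case: ltngtP le => // [|<-] _.
    by rewrite all_cat IH; have [] := fS j.
  by rewrite subnn drop0; have [] := fS j.
have [|||flt adm] := @fair_admissible r P L (size s0) stab.
- by move=> i; rewrite (re i.+1) ?szS //; apply: all_nthP (szS _); case: (gS i.+1).
- move=> i le; rewrite (re i.+1) ?szS //.
  rewrite -[X in nth _ _ X](subnKC le) -nth_drop.
  apply: (all_nthP _ (stS _)).
  by rewrite size_drop ltn_sub2r ?(leq_ltn_trans le (szS i.+1)) ?szS.
- move=> p i pP; pose j := i * #|P| + index p (enum P).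
  have idx : index p (enum P) < #|P| by rewrite cardE index_mem mem_enum.
  have prj : pr j = p.
    by rewrite /pr /j modnMDl modn_small // nth_index // mem_enum.
  have [_ _ _ [t' [d E]]] := fS j; move: E => /= E.
  have Sj1 : S j.+1 = rcons (S j ++ t') (full_receive (exec C0 (S j ++ t')) p d).
    by rewrite /= E prj rcons_cat.
  exists (size (S j ++ t')); rewrite (re j.+1) Sj1 ?size_rcons //.
  rewrite (rc j.+1) Sj1 ?size_rcons // nth_rcons ltnn eqxx.
  rewrite -cats1 take_size_cat //; split=> //.
  rewrite (@leq_trans j) //; last first.
    by rewrite size_cat (leq_trans (szS j)) ?leq_addr.
  by rewrite (leq_trans _ (leq_addr _ _)) // leq_pmulr.
exists r; split=> //; first by rewrite (rc 0) // take0.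
move=> m; exists (S m); split=> //; first by case: (gS m) => -[].
exact: rc.
Qed.

(** Letting exactly the processes of [P] continue after a safe finite schedule gives an admissible
    run; this transfers properties of infinite runs to finite schedules. *)
Lemma completion P L C0 s0 :
  stable P L -> initial C0 -> legal C0 s0 -> all safe_step s0 ->
  exists r : run A, [/\ admissible n.-1 detector r,
    faulty (pattern_of r) = ~: P, conf r 0 = C0,
    conf r (size s0) = exec C0 s0 &
    forall m, exists t, [/\ legal (exec C0 s0) t,
      all (fun e => [&& omitted e == set0, actor e \in P & fdval e == (P, L)]) t,
      m <= size (s0 ++ t) &
      conf r (size (s0 ++ t)) = exec C0 (s0 ++ t)]].
Proof.
move=> stab ini leg saf.
pose ok e := [&& omitted e == set0, actor e \in P & fdval e == (P, L)].
pose Inv s := legal C0 s /\ exists2 t, s = s0 ++ t & all ok t.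
have [||r [adm fl c0 H]] := @admissible_extension P L C0 s0 Inv stab ini leg saf.
- by split=> //; exists [::]; rewrite ?cats0.
- move=> s p [_ [t -> okt]] legs pP; exists [::], (P, L) => /=.
  rewrite !cats0 !andbT; split=> //.
  + by rewrite /safe_step /= eqxx (stable_safe stab pP) (stable_card stab) eqxx.
  + by rewrite /stable_step /= pP subxx eqxx.
  + split; first by apply/legal_cat; split=> //; split.
    rewrite -catA; eexists; first by [].
    by rewrite all_cat okt /= /ok /= !eqxx pP.
exists r; split=> //.
  have [s [_ [_ [t -> _]]]] := H 0.
  by move=> /(_ (size s0)) ->; rewrite ?size_cat ?leq_addr ?take_size_cat.
move=> m; have [s [ms [+ [t E okt]]]] := H m; rewrite {}E in ms *.
rewrite legal_cat => -[_ legt] cf; exists t; split=> //.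
by rewrite cf // take_size.
Qed.

(** * Consequences of solvability for finite schedules *)

Hypothesis k_le : 0 < k <= n.
Hypothesis solves : solves_set_agreement A n.-1 k detector.

Lemma stableT : exists L, stable [set: 'I_n] L.
Proof.
have [k0 kn] := andP k_le.
have cL := card_ord_interval 0 kn; rewrite subn0 in cL.
eexists; split; [by [] | exact: cL |].
by rewrite setIT -card_gt0 cL.
Qed.

(** The decisions made so far are decisions of a crash-free completion, to which agreement and
    validity apply. *)
Lemma safety C0 s :
  initial C0 -> legal C0 s -> all safe_step s ->
  #|[set v | [exists p, decision (state (exec C0 s) p) == Some v]]| <= k /\
  (forall p v, decision (state (exec C0 s) p) = Some v ->
     exists q, proposal (state C0 q) = v).
Proof.
move=> ini leg saf; have [L stab] := stableT.
have [r [adm _ c0 cs _]] := completion stab ini leg saf.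
have [agr val _] := solves adm; split=> [|p v dv].
  apply: leq_trans agr; apply/subset_leq_card/subsetP => v; rewrite !inE.
  move=> /existsP[p /eqP dv]; apply/asboolP; exists p, (size s).
  by rewrite cs.
by have [|q] := val p v; [exists (size s); rewrite cs | rewrite c0; exists q].
Qed.

Lemma termination_within P L C0 s p : stable P L -> p \in P ->
  initial C0 -> legal C0 s -> all safe_step s ->
  exists t v, [/\ legal (exec C0 s) t,
    all (fun e => [&& omitted e == set0, actor e \in P & fdval e == (P, L)]) t &
    decision (state (exec (exec C0 s) t) p) = Some v].
Proof.
move=> stab pP ini leg saf.
have [r [adm fl c0 _ H]] := completion stab ini leg saf.
have [_ _ /(_ p)] := solves adm; rewrite fl inE negbK pP => /(_ isT)[v [m dv]].
have [t [legt okt mt cf]] := H m; exists t, v; split=> //.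
rewrite -exec_cat -cf -(subnKC mt); elim: (_ - m) => [|i IH]; first by rewrite addn0.
by rewrite addnS run_next; apply: decision_next.
Qed.

(* Steps of [P] remain possible when the proposals outside [P] are replaced by
   one made in [P]. *)
Lemma validity_within P C0 s p v : p \in P ->
  initial C0 -> legal C0 s -> all safe_step s -> all (acts_in P) s ->
  decision (state (exec C0 s) p) = Some v ->
  exists2 q, q \in P & proposal (state C0 q) = v.
Proof.
move=> pP ini leg saf sP dv.
pose C1 : config A := Config (fun q => if q \in P then state C0 q else
   LState (proposal (state C0 p)) (decision (state C0 q)) (internal (state C0 q)))
  (buffer C0).
have ini1 : initial C1 by move=> q; have [? ? ?] := ini q; split=> //=; case: ifP.
have emb : embeds P C0 C1 by move=> q qP /=; rewrite qP.
have leg1 := embeds_legal emb sP leg.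
have [E _] := embeds_exec emb sP pP.
have [_ /(_ p v)] := safety ini1 leg1 saf.
rewrite -E => /(_ dv)[q] /=; case: ifP => [qP|_] <-; last by exists p.
by exists q.
Qed.

End FairRuns.

(** * Impossibility *)

Section Impossibility.
Variables (n k : nat) (V : finType) (M : Type).
Variable A : algorithm n V M ({set 'I_n} * {set 'I_n}).
(** [L] and [LQ] are the outputs of [Omega] in the steps of [B] and in the solo runs of [Q]. By
    [meetL], [L] contains a correct process even if one member of [B] crashes. *)
Variables (B Q L LQ : {set 'I_n}) (f : 'I_n -> V).
Hypotheses (k_gt1 : 1 < k) (k_le : k <= n).
Hypotheses (cardB : #|B| = 3) (cardQ : #|Q| = k.-1) (disjBQ : [disjoint B & Q]).
Hypotheses (cardL : #|L| = k) (cardLQ : #|LQ| = k) (subQ : Q \subset LQ).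
Hypothesis meetL : forall p, L :&: (B :\ p) != set0.
Hypothesis f_inj : injective f.
Hypothesis solves : solves_set_agreement A n.-1 k
  (pair_detector (@Sigma n k) (@Omega n k)).
Implicit Types (C : config A) (e : step n M ({set 'I_n} * {set 'I_n})).
Implicit Types (s t : seq (step n M ({set 'I_n} * {set 'I_n}))).
Implicit Types (P : {set 'I_n}) (p q : 'I_n) (u v w : V).

Definition quorum p (X : {set 'I_n}) : bool :=
  if p \in B then 1 < #|X :&: B|
  else if p \in Q then X != set0 else X == [set: 'I_n].

Lemma setT_neq0 : [set: 'I_n] != set0.
Proof.
rewrite -card_gt0 cardsT card_ord.
by apply: leq_trans k_le; apply: ltnW.
Qed.

Lemma quorumT p : quorum p [set: 'I_n].
Proof. by rewrite /quorum setTI cardB setT_neq0 eqxx !if_same. Qed.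

Lemma quorum_neq0 p X : quorum p X -> X != set0.
Proof.
rewrite /quorum; case: ifP => _.
  by apply: contraTneq => ->; rewrite set0I cards0.
by case: ifP => // _ /eqP->; apply: setT_neq0.
Qed.

(** Either one of the [k.+1] processes lies outside [B] and [Q] and outputs everything, or two lie
    in [B], since [Q] has only [k.-1] elements; two majorities of a set of three meet. *)
Lemma quorum_inter (p : 'I_k.+1 -> 'I_n) (X : 'I_k.+1 -> {set 'I_n}) :
  injective p -> (forall i, quorum (p i) (X i)) ->
  exists i j, i != j /\ X i :&: X j != set0.
Proof.
move=> injp qX; have neq0 i : X i != set0 := quorum_neq0 (qX i).
have [i /andP[iB iQ]|inBQ] := pickP (fun i => (p i \notin B) && (p i \notin Q)).
  have [j ij] : exists j, i != j.
    have : 1 < #|'I_k.+1| by rewrite card_ord ltnS ltnW.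
    case/card_gt1P=> x [y [_ _ xy]].
    by case: (eqVneq i x) => [->|]; [exists y | exists x].
  exists i, j; split=> //; have := qX i.
  by rewrite /quorum (negPf iB) (negPf iQ) => /eqP->; rewrite setTI.
have : 1 < #|[set i | p i \in B]|.
  have := cardsC [set i | p i \in B]; rewrite card_ord => E.
  have : #|~: [set i | p i \in B]| <= k.-1.
    rewrite -cardQ -(card_imset _ injp); apply/subset_leq_card/subsetP.
    move=> _ /imsetP[i + ->]; rewrite !inE => iB.
    by have := inBQ i; rewrite iB /= => /negbFE.
  move=> le; rewrite ltnNge; apply/negP => le1; have := leq_add le1 le.
  by rewrite E add1n prednK ?ltnn // ltnW.
case/card_gt1P=> i [j []]; rewrite !inE => iB jB ij.
exists i, j; split=> //; have := qX i; have := qX j.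
rewrite /quorum iB jB => cj ci; have := cardsUI (X i :&: B) (X j :&: B).
have : #|X i :&: B :|: X j :&: B| <= 3.
  by rewrite -cardB subset_leq_card // subUset !subsetIr.
have [E|//] := eqVneq (X i :&: X j) set0.
rewrite setIACA E set0I cards0 addn0 => le3 E4.
by have := leq_add ci cj; rewrite -E4 => /leq_trans/(_ le3).
Qed.

Notation safe := (safe_step k quorum).

Definition bstep e := [&& omitted e == set0, actor e \in B,
  (fdval e).1 \subset B, 1 < #|(fdval e).1| & (fdval e).2 == L].

Lemma bstep_safe e : bstep e -> safe e.
Proof.
case/and5P=> om aB sB c2 /eqP eL.
by rewrite /safe_step om /quorum aB (setIidPl sB) c2 eL cardL eqxx.
Qed.

Lemma bsteps_safe s : all bstep s -> all safe s.
Proof. exact/sub_all/bstep_safe. Qed.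

Lemma bsteps_acts s : all bstep s -> all (acts_in B) s.
Proof. by apply: sub_all => e /and5P[]. Qed.

Lemma cardBD1 p : p \in B -> #|B :\ p| = 2.
Proof. by move=> pB; have := cardsD1 p B; rewrite cardB pB => -[]. Qed.

Lemma quorum_sub p P : p \in B -> P \subset B -> 1 < #|P| -> quorum p P.
Proof. by move=> pB PB cP; rewrite /quorum pB (setIidPl PB). Qed.

Lemma stableB : stable k quorum B L.
Proof.
split=> // [p pB|]; first by rewrite quorum_sub // cardB.
have [p pB] : exists p, p \in B by apply/set0Pn; rewrite -card_gt0 cardB.
by apply: contraNneq (meetL p) => E; rewrite -subset0 -E setIS ?subD1set.
Qed.

Lemma stableBD1 p : p \in B -> stable k quorum (B :\ p) L.
Proof.
move=> pB; split=> // q /setD1P[_ qB].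
by rewrite quorum_sub ?subD1set // cardBD1.
Qed.

Lemma stable_solo q : q \in Q -> stable k quorum [set q] LQ.
Proof.
move=> qQ; have qnB : q \notin B by rewrite (disjointFl disjBQ).
have q0 : [set q] != set0 by apply/set0Pn; exists q; rewrite set11.
split=> // [p /set1P->|]; first by rewrite /quorum (negPf qnB) qQ.
by rewrite (setIidPr _) // sub1set (subsetP subQ).
Qed.

Lemma k_bounds : 0 < k <= n.
Proof. by rewrite k_le (ltnW k_gt1). Qed.

(** * Solo runs of [Q] and agreement within [B] *)

Definition start (g : 'I_n -> V) : config A :=
  Config (fun p => LState (g p) None (init A p)) (fun _ _ => False).
Notation C0 := (start f).

Lemma initial_start g : initial (start g).
Proof. by move=> p; split=> // m. Qed.

(** If [q] alone is correct it must decide, and as only [q] takes steps, [validity_within] leaves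
    only its own proposal. *)
Lemma solo_decision q : q \in Q -> exists t, [/\ legal C0 t, all safe t,
  all (acts_in [set q]) t & decision (state (exec C0 t) q) = Some (f q)].
Proof.
move=> qQ; have stab := stable_solo qQ.
have [||t [v [leg okt dv]]] := termination_within quorumT quorum_inter solves
  (s := [::]) stab (set11 q) (initial_start f) => //.
have saf : all safe t.
  apply: sub_all okt => e /and3P[om /set1P ae /eqP ed].
  rewrite /safe_step om ed ae cardLQ eqxx andbT /=.
  by apply: (stable_safe stab); rewrite set11.
have act : all (acts_in [set q]) t by apply: sub_all okt => e /and3P[].
have [q' /set1P-> /= E] := validity_within quorumT quorum_inter k_bounds solves
  (set11 q) (initial_start f) leg saf act dv.
by exists t; rewrite E.
Qed.

(** Solo runs can be concatenated: those of other processes only add messages to the buffer of [q],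
    which [q] may leave there. *)
Lemma solo_decisions (qs : seq 'I_n) : uniq qs -> {subset qs <= Q} ->
  exists t, [/\ legal C0 t, all safe t, all (acts_in [set x in qs]) t &
    forall q, q \in qs -> decision (state (exec C0 t) q) = Some (f q)].
Proof.
elim: qs => [|q qs IH] /=; first by exists [::].
move=> /andP[qqs uqs] sub.
have [|t [legt saft actt dect]] := IH uqs.
  by move=> x xqs; apply: sub; rewrite inE xqs orbT.
have [|t' [legt' saft' actt' dect']] := @solo_decision q.
  by apply: sub; rewrite inE eqxx.
have emb : embeds [set q] C0 (exec C0 t).
  apply: embeds_other; apply: sub_all actt => e; rewrite /acts_in /= !inE.
  by apply: contraTneq => ->.
exists (t ++ t'); split.
- by apply/legal_cat; split=> //; apply: embeds_legal emb actt' legt'.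
- by rewrite all_cat saft.
- rewrite all_cat; apply/andP; split; [apply: sub_all actt|apply: sub_all actt'].
    by move=> e; rewrite /acts_in !inE => ->; rewrite orbT.
  by move=> e; rewrite /acts_in !inE => ->.
move=> x; rewrite inE exec_cat => /predU1P[->|xqs].
  by have [<- _] := embeds_exec emb actt' (set11 q).
exact/decision_exec/dect.
Qed.

(* After the solo runs of [Q], which remain invisible to [B], two different
   decisions in [B] would be the [k]-th and the [k.+1]-st. *)
Lemma agreementB s p q u v : legal C0 s -> all bstep s -> p \in B -> q \in B ->
  decision (state (exec C0 s) p) = Some u ->
  decision (state (exec C0 s) q) = Some v -> u = v.
Proof.
move=> leg bs pB qB du dv; apply: contraTeq isT => uv.
have val x w : x \in B -> decision (state (exec C0 s) x) = Some w ->
    exists2 y, y \in B & f y = w.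
  move=> xB; exact: (validity_within quorumT quorum_inter k_bounds solves) xB
    (initial_start f) leg (bsteps_safe bs) (bsteps_acts bs).
have [t [legt saft actt dect]] := solo_decisions (enum_uniq Q)
  (fun x => etrans (esym (mem_enum _ x))).
have emb : embeds B C0 (exec C0 t).
  apply: embeds_other; apply: sub_all actt => e; rewrite /acts_in /= !inE.
  by rewrite mem_enum => eQ; rewrite (disjointFl disjBQ).
have actB := bsteps_acts bs.
have [] := @safety _ _ _ _ A _ quorumT quorum_inter k_bounds solves
  C0 (t ++ s) (initial_start f).
- by apply/legal_cat; split=> //; apply: embeds_legal emb actB leg.
- by rewrite all_cat saft bsteps_safe.
move=> + _; apply: contraLR => _; rewrite -ltnNge.
have notQ x w : x \in B -> decision (state (exec C0 s) x) = Some w ->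
    w \notin f @: Q.
  move=> xB /(val _ _ xB)[y yB <-]; rewrite mem_imset //.
  by rewrite (disjointFr disjBQ).
(* [u] and [v] are proposals of [B], hence differ from the [k.-1] proposals of [Q]. *)
have <- : #|u |: (v |: f @: Q)| = k.+1.
  rewrite !cardsU1 (notQ q) // !inE (negPf uv) (notQ p) //= card_imset //.
  by rewrite cardQ !add1n prednK // ltnW.
apply/subset_leq_card/subsetP => w.
rewrite !inE exec_cat => /or3P[/eqP->|/eqP->|/imsetP[x xQ ->]]; apply/existsP.
- by exists p; have [<- _] := embeds_exec emb actB pB; rewrite du.
- by exists q; have [<- _] := embeds_exec emb actB qB; rewrite dv.
by exists x; apply/eqP/decision_exec/dect; rewrite mem_enum.
Qed.

(** * Valency in [B], with and without a given process *)

Definition reachable C := exists s, [/\ legal C0 s, all bstep s & C = exec C0 s].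

Definition can_decide P C v := exists t x, [/\ legal C t, all bstep t,
  all (acts_in P) t, x \in P & decision (state (exec C t) x) = Some v].

Definition bivalent P C :=
  exists u v, [/\ u != v, can_decide P C u & can_decide P C v].

Lemma reachable_exec C s :
  reachable C -> legal C s -> all bstep s -> reachable (exec C s).
Proof.
move=> [t [legt bt ->]] leg bs; exists (t ++ s).
by rewrite all_cat bt exec_cat; split=> //; apply/legal_cat.
Qed.

Lemma can_decideS P P' C v : P \subset P' -> can_decide P C v ->
  can_decide P' C v.
Proof.
move=> /subsetP PP' [t [x [leg bt act xP dv]]]; exists t, x; split=> //.
  by apply: sub_all act => e; apply: PP'.
exact: PP'.
Qed.

Lemma bivalentS P P' C : P \subset P' -> bivalent P C -> bivalent P' C.
Proof.
by move=> PP' [u [v [uv du dv]]]; exists u, v; split=> //; apply: can_decideS PP' _.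
Qed.

(** If [p] crashes, the other two members of [B] still form a quorum and [L] meets them, so they
    must decide. *)
Lemma can_decideBD1 C p : reachable C -> p \in B ->
  exists v, can_decide (B :\ p) C v.
Proof.
move=> [s [leg bs ->]] pB; have stab := stableBD1 pB.
have [x xP] : exists x, x \in B :\ p.
  by apply/set0Pn; rewrite -card_gt0 cardBD1.
have [t [v [legt okt dv]]] := termination_within quorumT quorum_inter
  solves stab xP (initial_start f) leg (bsteps_safe bs).
exists v, t, x; split=> //; apply: sub_all okt => e /and3P[om] // aP /eqP ed.
rewrite /bstep om ed /= (subsetP (subD1set B p)) // subD1set cardBD1 //.
by rewrite eqxx.
Qed.

Lemma decided_unique C x u v : reachable C -> x \in B ->
  decision (state C x) = Some u -> can_decide B C v -> v = u.
Proof.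
move=> reC xB du [t [y [leg bt _ yB dv]]].
have [s [legs bs E]] := reachable_exec reC leg bt; rewrite E in dv.
apply: (agreementB legs bs yB xB dv).
by rewrite -E; apply: decision_exec.
Qed.

Lemma can_decide_own_step C e p v : bstep e -> actor e = p ->
  can_decide (B :\ p) C v -> can_decide (B :\ p) (next_config C e) v.
Proof.
move=> be ae [t [x [leg bt act xP dv]]].
have emb : embeds (B :\ p) C (next_config C e).
  by apply: embeds_other_step; rewrite /acts_in ae !inE eqxx.
exists t, x; split=> //; first exact: embeds_legal emb act leg.
by have [<- _] := embeds_exec emb act xP.
Qed.

Lemma can_decide_other_step P C e v : legitimate C e -> bstep e ->
  actor e \in P -> can_decide P (next_config C e) v -> can_decide P C v.
Proof.
move=> le be aP [t [x [leg bt act xP dv]]].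
by exists (e :: t), x; split=> //=; apply/andP.
Qed.

(** Consider the first step after which [v] is no longer decidable without [p]; it exists because
    [w] is decided in the end. It is not a step of [p], so a value decidable without [p] after it
    was decidable before it too, alongside [v]. *)
Lemma bivalent_on_the_way p C s v w x : p \in B -> reachable C -> legal C s ->
  all bstep s -> can_decide (B :\ p) C v -> v != w -> x \in B ->
  decision (state (exec C s) x) = Some w ->
  exists t, [/\ legal C t, all bstep t & bivalent (B :\ p) (exec C t)].
Proof.
move=> pB + + + + vw xB; elim: s C => [|e s IH] C reC /=.
  move=> _ _ dv dw; case/eqP: vw; apply: decided_unique reC xB dw _.
  exact: can_decideS (subD1set _ _) dv.
move=> [le leg] /andP[be bs] dv dw.
have reC' : reachable (next_config C e).
  by apply: (@reachable_exec C [:: e]) => //=; rewrite be.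
have [dv'|ndv] := pselect (can_decide (B :\ p) (next_config C e) v).
  have [t [legt bt biv]] := IH _ reC' leg bs dv' dw.
  by exists (e :: t) => /=; rewrite be.
have aP : actor e \in B :\ p.
  rewrite !inE; apply/andP; split; last by case/and5P: be.
  by apply/eqP => ae; apply: ndv; apply: can_decide_own_step.
have [v' dv'] := can_decideBD1 reC' pB.
exists [::]; split=> //; exists v, v'; split=> //.
  by apply: contra_notN ndv => /eqP->.
exact: can_decide_other_step dv'.
Qed.

Lemma bivalent_without p C : p \in B -> reachable C -> bivalent B C ->
  exists t, [/\ legal C t, all bstep t & bivalent (B :\ p) (exec C t)].
Proof.
move=> pB reC [u [w [uw du dw]]]; have [v dv] := can_decideBD1 reC pB.
have [z vz [t [x [leg bt _ xB dz]]]] : exists2 z, v != z & can_decide B C z.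
  by have [->|vu] := eqVneq v u; [exists w | exists u].
exact: bivalent_on_the_way leg bt dv vz xB dz.
Qed.

(** Without [a], the proposal of some other [b] can be decided; without this [b], a different
    proposal can. *)
Lemma bivalent_start : bivalent B C0.
Proof.
have re0 : reachable C0 by exists [::].
have own p v : can_decide (B :\ p) C0 v ->
    exists q, [/\ q \in B, q != p & v = f q].
  move=> [t [x [leg bt act xP dv]]].
  have [q /setD1P[qp qB] /= <-] := validity_within quorumT quorum_inter k_bounds
    solves xP (initial_start f) leg (bsteps_safe bt) act dv.
  by exists q.
have [a aB] : exists a, a \in B by apply/set0Pn; rewrite -card_gt0 cardB.
have [v dv] := can_decideBD1 re0 aB; have [b [bB ba E]] := own _ _ dv.
have [w dw] := can_decideBD1 re0 bB; have [c [cB cb E']] := own _ _ dw.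
exists v, w; split; first by rewrite E E' (inj_eq f_inj) eq_sym.
  exact: can_decideS (subD1set B a) dv.
exact: can_decideS (subD1set B b) dw.
Qed.

Lemma no_solution : False.
Proof.
pose Inv s := [/\ legal C0 s, all bstep s & bivalent B (exec C0 s)].
have bfull C p : p \in B -> bstep (full_receive C p (B, L)).
  by move=> pB; rewrite /bstep /= !eqxx pB subxx cardB.
have bstable e : bstep e -> stable_step B L e.
  by case/and5P=> _ aB sB _ eL; apply/and3P.
have [|||s p|r [adm fl _ H]] := admissible_extension quorumT quorum_inter
  (s0 := [::]) (Inv := Inv) stableB (initial_start f) => //.
- by split=> //; apply: bivalent_start.
- move=> [leg bs biv] _ pB.
  have reC : reachable (exec C0 s) by exists s.
  have [t [legt bt bivt]] := bivalent_without pB reC biv.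
  exists t, (B, L); set e := full_receive _ _ _.
  have brt : all bstep (rcons t e) by rewrite all_rcons bfull.
  split; first by apply/legal_cat.
  + exact: bsteps_safe.
  + by apply: sub_all brt.
  split; [|by rewrite all_cat bs|].
    rewrite -rcons_cat -cats1; apply/legal_cat; split; first exact/legal_cat.
    by split.
  (* The two values decidable without [p] survive the full receive by [p], which restores bivalence
     in [B]. *)
  rewrite -rcons_cat -cats1 exec_cat /=; apply: bivalentS (subD1set B p) _.
  rewrite -exec_cat in bivt; have [u [v [uv du dv]]] := bivt.
  by exists u, v; split=> //; apply: can_decide_own_step; rewrite ?bfull.
have [_ _ ter] := solves adm.
have [x xB] : exists x, x \in B by apply/set0Pn; rewrite -card_gt0 cardB.
have [|v [m dv]] := ter x; first by rewrite fl inE negbK.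
(* This prefix has length at least [m], so [x] has already decided in it, contradicting
   bivalence. *)
have [s [ms [leg bs [u [w [uw du dw]]]] cf]] := H m.
have re : reachable (exec C0 s) by exists s.
have dx : decision (state (exec C0 s) x) = Some v.
  rewrite -(cat_take_drop m s) exec_cat; apply: decision_exec.
  by rewrite -cf.
case/eqP: uw.
by rewrite (decided_unique re xB dx du) (decided_unique re xB dx dw).
Qed.

End Impossibility.

Theorem theorem10 (n k : nat) (hk : 2 <= k) (hkn : k + 2 <= n)
    (V : finType) (hV : n <= #|V|) (M : Type) :
  ~ exists A : algorithm n V M ({set 'I_n} * {set 'I_n}),
      solves_set_agreement A n.-1 k (pair_detector (@Sigma n k) (@Omega n k)).
Proof.
move=> [A solves]; have n_gt3 : 3 < n.
  by apply: leq_trans hkn; rewrite addn2 !ltnS.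
have kn : k <= n by apply: leq_trans hkn; apply: leq_addr.
pose I a b := [set i : 'I_n | a <= i < b].
pose f (i : 'I_n) : V := enum_val (widen_ord hV i).
(* [B] is {0, 1, 2} and [Q] is {3, ..., k+1}, which fits since k + 2 <= n. [L] = {0, ..., k-1}
   contains 0 and 1 as k >= 2, so it still meets [B] after the removal of any [p]; [LQ] = {2, ...,
   k+1} extends [Q] to k elements. *)
apply: (@no_solution n k V M A (I 0 3) (I 3 (k + 2)) (I 0 k) (I 2 (k + 2)) f);
  rewrite ?card_ord_interval ?addnK ?subn0 ?(ltnW n_gt3) //.
- by rewrite addn2 subSS subSS subn1.
- rewrite disjoints_subset; apply/subsetP => i.
  by rewrite !inE /= ltnNge => /negPf ->.
- by apply/subsetP => i; rewrite !inE => /andP[/ltnW-> ->].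
- move=> p; have n0 : 0 < n by exact: ltn_trans n_gt3.
  have n1 : 1 < n by exact: ltn_trans n_gt3.
  apply/set0Pn; have [->|p0] := eqVneq p (Ordinal n0).
    by exists (Ordinal n1); rewrite !inE /= hk.
  by exists (Ordinal n0); rewrite !inE eq_sym p0 (ltnW hk).
- by move=> i j /enum_val_inj/(congr1 val) /= /val_inj.
Qed.
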